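(* Consider the market model described in the context in the special case $\gamma(\mathbf 0)=\gamma(\mathbf 1)=\gamma$, and let $\lambda\ge0$. For $n=1,\dots,N$ define the value function $$\bar{V}^{\lambda}_{n}(x,i,s):=\sup_{\alpha\in \Pi_{t_{N-n}} } \mathbb{E}_{ t_{N-n}}\big[-\exp(-\gamma(X^{\alpha}_T-\lambda F(S_T^1,S_T^2)))\big].$$ This supremum is attained; let $$(\bar{\alpha}_{N-n}^\lambda,\bar{\alpha}_{N-n+1}^\lambda, \cdots,\bar{\alpha}_{N-1}^\lambda)=\arg \max_{\alpha\in \Pi_{t_{N-n}}} \mathbb{E}_{t_{N-n}}\big[-\exp(-\gamma(X^{\alpha}_T-\lambda F(S_T^1,S_T^2)))\big]$$ be the optimal strategy at $t_{N-n}$. Then for every $n=0,1,\dots,N-1$, $$\bar{\alpha}_n^\lambda=\hat{\alpha}_n^\lambda,$$ where $\hat\alpha^\lambda$ are the equilibrium strategies.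
   Context: Time grid: $T>0$, $N$ a positive integer, $h=T/N$, $t_n=nh$ for $n=0,\dots,N$; $\Delta$ is the forward difference, $\Delta b_{t_n}:=b_{t_{n+1}}-b_{t_n}$. Randomness: on a complete filtered probability space $(\Omega,\mathcal{F},\{\mathcal{F}_{t_n}\},\mathbb{P})$, $(b^1,b^2)$ is a two-dimensional binomial random walk, symmetric in the sense that $\mathbb{P}(\Delta b^i_{t_n}=\pm1)=1/2$, $i=1,2$, and $J$ is a discrete time homogeneous Markov chain with values in $\{\mathbf{0},\mathbf{1}\}$. The distribution of $J_0$ is known and $\mathbb{P}(J_0=i|\mathcal{F}^S_0)=\mathbb{P}(J_0=i)$, where $\{\mathcal{F}^S_{t_n}\}$ is the filtration generated by the process $S=(S^1,S^2)$ below. The filtration $\{\mathcal{F}_{t_n}\}$ is generated by $(b^1,b^2)$ and $J$. Assets: the bond is the numeraire (zero interest). The traded stock satisfies $\Delta S_{t_n}^1=S_{t_n}^1(\mu^1_{t_n}h+\sigma^1_{t_n}\sqrt{h}\,\Delta b_{t_n}^1)$, $S^1_0=s^1>0$, with adapted $\mu^1,\sigma^1$ chosen so that $S^1$ remains positive. The non-traded asset satisfies $\Delta S_{t_n}^2=S_{t_n}^2(\mu^2_{t_n}h+\sigma^2_{t_n}\sqrt{h}(\rho\Delta b_{t_n}^1+\sqrt{1-\rho^2}\,\Delta b_{t_n}^2))$, $S^2_0=s^2>0$, with adapted $\mu^2,\sigma^2$ and $|\rho|\le1$. The market price of risk is $\theta^1_{t_n}=\mu^1_{t_n}/\sigma^1_{t_n}$,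 chosen such that $0\le\theta^1_{t_n}\le1/\sqrt{h}$. Wealth: $\alpha_{n}\in\mathcal{F}_{t_n}$ is the wealth invested in stock at $t_n$; $\Delta X^{\alpha}_{t_n}=\alpha_{n}(\mu^1_{t_n} h+\sigma^1_{t_n}\sqrt{h}\,\Delta b_{t_n}^1)$. $\Pi_{t_n}$ is the set of $(\alpha_n,\dots,\alpha_{N-1})$ with $\alpha_k\in\mathcal{F}_{t_k}$ and $\mathbb{E}^{\mathbb{P}}|X^\alpha_{t_k}|<\infty$, $k=n,\dots,N-1$. Notation: $\mathbb{E}_{t_n}[\cdot]=\mathbb{E}^{\mathbb{P}}[\cdot|X_{t_n}=x,J_{t_n}=i,S_{t_n}=s]$. Preferences and claim: in general $\gamma(\mathbf 0),\gamma(\mathbf 1)>0$ are the absolute risk aversions in the two regimes. $F$ is a measurable function; the claim pays $F(S^1_T,S^2_T)$ at $T$, and $\lambda\ge0$ is the number of shares written. Equilibrium strategies $\hat\alpha^\lambda$ are defined by backward recursion: at step $n=1,\dots,N$, given the already determined $\hat\alpha^\lambda_{N-n+1},\dots,\hat\alpha^\lambda_{N-1}$ (none when $n=1$), restrict to admissible strategies $\alpha=(\alpha_{N-n},\hat\alpha^\lambda_{N-n+1},\dots,\hat\alpha^\lambda_{N-1})\in\Pi_{t_{N-n}}$ with $\alpha_{N-n}$ an arbitrary $\mathcal{F}_{t_{N-n}}$-measurable control; $\hat\alpha^\lambda_{N-n}$ is the maximizing $\alpha_{N-n}$ of $\mathbb{E}[-\exp(-\gamma(J_{t_{N-n}})(X^\alpha_T-\lambda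 F(S^1_T,S^2_T)))|\mathcal{F}_{t_{N-n}}]$ over such $\alpha$. *)

(* Defs.v *)
From HB Require Import structures.
From mathcomp Require Import all_boot all_order all_algebra.
From mathcomp Require Import all_classical all_reals all_analysis.

Set Implicit Arguments.
Unset Strict Implicit.
Unset Printing Implicit Defensive.

Import Order.TTheory GRing.Theory Num.Theory.
Import numFieldNormedType.Exports.

Local Open Scope classical_set_scope.
Local Open Scope ring_scope.

(* The sub-sigma-algebra <<s G>> is handled through its generators G, so that
   measurability is the library's, on g_sigma_algebraType G. *)
Definition measurable_wrt (R : realType) (Omega : pointedType) (G : set (set Omega))
    (X : Omega -> R) : Prop :=
  measurable_fun setT (X : g_sigma_algebraType G -> R).

Definition is_cexp (R : realType) (d : measure_display)
    (Omega : measurableType d) (P : probability Omega R)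
    (G : set (set Omega)) (X Y : Omega -> R) : Prop :=
  [/\ measurable_wrt G Y,
      P.-integrable setT (EFin \o Y) &
      forall A : set Omega, <<s G >> A ->
        (\int[P]_(w in A) (Y w)%:E = \int[P]_(w in A) (X w)%:E)%E].

(* E[X | <<s G>>]: some version of it (0 if there is none). *)
Definition cexp (R : realType) (d : measure_display)
    (Omega : measurableType d) (P : probability Omega R)
    (G : set (set Omega)) (X : Omega -> R) : Omega -> R :=
  xget (cst 0) [set Y | is_cexp P G X Y].

(* E[X | A] for an event A of positive probability. *)
Definition cexp_event (R : realType) (d : measure_display)
    (Omega : measurableType d) (P : probability Omega R)
    (A : set Omega) (X : Omega -> R) : R :=
  fine (\int[P]_(w in A) (X w)%:E)%E / fine (P A).

(* All processes are indexed by k, standing for t_k = k h; the walk, the chain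
   and the prices matter for k <= N, the coefficients for k < N.
   Regimes: false is 0 and true is 1. *)
Record market (R : realType) (Omega : Type) := Market {
  horizon : R;
  nsteps : nat;
  walk1 : nat -> Omega -> R;
  walk2 : nat -> Omega -> R;
  regime : nat -> Omega -> bool;
  drift1 : nat -> Omega -> R;
  vol1 : nat -> Omega -> R;
  drift2 : nat -> Omega -> R;
  vol2 : nat -> Omega -> R;
  rho : R;
  s01 : R;
  s02 : R }.

Definition mesh (R : realType) (Omega : Type) (M : market R Omega) : R :=
  horizon M / (nsteps M)%:R.

(* Forward difference. *)
Definition fdiff (R : realType) (Omega : Type) (b : nat -> Omega -> R)
    (k : nat) (w : Omega) : R :=
  b k.+1 w - b k w.

Definition dwalk (R : realType) (Omega : Type) (M : market R Omega) (k : nat)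
    (w : Omega) : R * R :=
  (fdiff (walk1 M) k w, fdiff (walk2 M) k w).

Definition ret1 (R : realType) (Omega : Type) (M : market R Omega) (k : nat)
    (w : Omega) : R :=
  drift1 M k w * mesh M + vol1 M k w * Num.sqrt (mesh M) * fdiff (walk1 M) k w.

Definition ret2 (R : realType) (Omega : Type) (M : market R Omega) (k : nat)
    (w : Omega) : R :=
  drift2 M k w * mesh M + vol2 M k w * Num.sqrt (mesh M) *
    (rho M * fdiff (walk1 M) k w +
     Num.sqrt (1 - rho M ^+ 2) * fdiff (walk2 M) k w).

Fixpoint stock1 (R : realType) (Omega : Type) (M : market R Omega) (k : nat)
    (w : Omega) {struct k} : R :=
  match k with
  | 0%N => s01 M
  | k'.+1 => stock1 M k' w + stock1 M k' w * ret1 M k' w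
  end.

Fixpoint stock2 (R : realType) (Omega : Type) (M : market R Omega) (k : nat)
    (w : Omega) {struct k} : R :=
  match k with
  | 0%N => s02 M
  | k'.+1 => stock2 M k' w + stock2 M k' w * ret2 M k' w
  end.

Definition stocks (R : realType) (Omega : Type) (M : market R Omega) (k : nat)
    (w : Omega) : R * R :=
  (stock1 M k w, stock2 M k w).

Definition price_of_risk (R : realType) (Omega : Type) (M : market R Omega)
    (k : nat) (w : Omega) : R :=
  drift1 M k w / vol1 M k w.

(* Generators of F_{t_n}: the values of b^1, b^2, J up to t_n together with the
   P-null sets, the filtration being complete. *)
Definition filtr_gen (R : realType) (d : measure_display)
    (Omega : measurableType d) (P : probability Omega R)
    (M : market R Omega) (n : nat) : set (set Omega) :=
  [set A | P.-negligible A \/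
    exists2 k : nat, (k <= n)%N &
      [\/ exists2 B : set R, measurable B & A = walk1 M k @^-1` B,
          exists2 B : set R, measurable B & A = walk2 M k @^-1` B |
          exists i : bool, A = regime M k @^-1` [set i]]].

(* Generators of F^S_{t_n}. *)
Definition stock_filtr_gen (R : realType) (Omega : Type) (M : market R Omega)
    (n : nat) : set (set Omega) :=
  [set A | exists2 k : nat, (k <= n)%N &
    exists2 B : set (R * R), measurable B & A = stocks M k @^-1` B].

(* Increments independent of the past F_{t_k}, identically distributed, with
   symmetric +1/-1 components; the dependence between the two components at a
   given time is not restricted. *)
Definition binomial_walk (R : realType) (d : measure_display)
    (Omega : measurableType d) (P : probability Omega R)
    (M : market R Omega) : Prop :=
  [/\ forall k : nat, (k <= nsteps M)%N ->
        measurable_fun setT (walk1 M k) /\ measurable_fun setT (walk2 M k),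
      walk1 M 0%N = cst 0 /\ walk2 M 0%N = cst 0,
      forall k : nat, (k < nsteps M)%N ->
        [/\ P (fdiff (walk1 M) k @^-1` [set 1]) = (2^-1)%:E,
            P (fdiff (walk1 M) k @^-1` [set -1]) = (2^-1)%:E,
            P (fdiff (walk2 M) k @^-1` [set 1]) = (2^-1)%:E &
            P (fdiff (walk2 M) k @^-1` [set -1]) = (2^-1)%:E],
      forall (k : nat) (A : set Omega) (B : set (R * R)), (k < nsteps M)%N ->
        <<s filtr_gen P M k >> A -> measurable B ->
        P (A `&` dwalk M k @^-1` B) = (P A * P (dwalk M k @^-1` B))%E &
      forall (k : nat) (B : set (R * R)), (k < nsteps M)%N -> measurable B ->
        P (dwalk M k @^-1` B) = P (dwalk M 0%N @^-1` B)].

Definition regime_path (R : realType) (Omega : Type) (M : market R Omega)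
    (n : nat) (j : nat -> bool) : set Omega :=
  [set w | forall k : nat, (k <= n)%N -> regime M k w = j k].

Definition homogeneous_chain (R : realType) (d : measure_display)
    (Omega : measurableType d) (P : probability Omega R)
    (M : market R Omega) : Prop :=
  (forall (k : nat) (i : bool), (k <= nsteps M)%N ->
     measurable (regime M k @^-1` [set i])) /\
  exists p : bool -> bool -> R,
    [/\ forall i i' : bool, 0 <= p i i',
        forall i : bool, p i false + p i true = 1 &
        forall (n : nat) (j : nat -> bool), (n < nsteps M)%N ->
          P (regime_path M n.+1 j) =
          (P (regime_path M n j) * (p (j n) (j n.+1))%:E)%E].

Record market_model (R : realType) (d : measure_display)
    (Omega : measurableType d) (P : probability Omega R)
    (M : market R Omega) : Prop := MarketModel {
  horizon_gt0 : 0 < horizon M;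
  nsteps_gt0 : (0 < nsteps M)%N;
  complete_P : measure_is_complete P;
  walk_P : binomial_walk P M;
  regime_P : homogeneous_chain P M;
  regime0_P : forall i : bool,
    is_cexp P (stock_filtr_gen M 0%N) \1_(regime M 0%N @^-1` [set i])
      (cst (fine (P (regime M 0%N @^-1` [set i]))));
  coef_adapted : forall k : nat, (k < nsteps M)%N ->
    [/\ measurable_wrt (filtr_gen P M k) (drift1 M k),
        measurable_wrt (filtr_gen P M k) (vol1 M k),
        measurable_wrt (filtr_gen P M k) (drift2 M k) &
        measurable_wrt (filtr_gen P M k) (vol2 M k)];
  s01_gt0 : 0 < s01 M;
  s02_gt0 : 0 < s02 M;
  rho_le1 : `|rho M| <= 1;
  stock1_gt0 : forall k : nat, (k <= nsteps M)%N ->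
    {ae P, forall w, 0 < stock1 M k w};
  (* implicit in theta^1 = mu^1 / sigma^1 being well defined *)
  vol1_neq0 : forall k : nat, (k < nsteps M)%N ->
    {ae P, forall w, vol1 M k w != 0};
  price_of_risk_bounds : forall k : nat, (k < nsteps M)%N ->
    {ae P, forall w, 0 <= price_of_risk M k w <= (Num.sqrt (mesh M))^-1} }.

(* X^alpha_{t_k} for k >= m, where xi = X_{t_m} is the wealth at the starting
   date t_m; only alpha_m, ..., alpha_{k-1} are used. *)
Definition wealth (R : realType) (Omega : Type) (M : market R Omega) (m : nat)
    (xi : Omega -> R) (alpha : nat -> Omega -> R) (k : nat) (w : Omega) : R :=
  xi w + \sum_(m <= j < k) alpha j w * ret1 M j w.

(* Pi_{t_m}. *)
Definition admissible (R : realType) (d : measure_display)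
    (Omega : measurableType d) (P : probability Omega R)
    (M : market R Omega) (m : nat) (xi : Omega -> R)
    (alpha : nat -> Omega -> R) : Prop :=
  forall k : nat, (m <= k < nsteps M)%N ->
    measurable_wrt (filtr_gen P M k) (alpha k) /\
    (\int[P]_w (`|wealth M m xi alpha k w|)%:E < +oo)%E.

(* -exp(-g (X^alpha_T - lambda F(S_T))), with g possibly random. *)
Definition terminal_utility (R : realType) (Omega : Type) (M : market R Omega)
    (g : Omega -> R) (lambda : R) (F : R * R -> R) (m : nat) (xi : Omega -> R)
    (alpha : nat -> Omega -> R) (w : Omega) : R :=
  - expR (- (g w * (wealth M m xi alpha (nsteps M) w -
                    lambda * F (stocks M (nsteps M) w)))).

Definition replace_at (R : realType) (Omega : Type)
    (alpha : nat -> Omega -> R) (m : nat) (a : Omega -> R) :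
    nat -> Omega -> R :=
  fun k => if k == m then a else alpha k.

(* Only alphahat_0, ..., alphahat_{N-1} are constrained.  At each date t_{N-n}
   the maximization holds whatever the wealth xi = X_{t_{N-n}} then is. *)
Definition equilibrium (R : realType) (d : measure_display)
    (Omega : measurableType d) (P : probability Omega R)
    (M : market R Omega) (gam : bool -> R) (lambda : R) (F : R * R -> R)
    (alphahat : nat -> Omega -> R) : Prop :=
  forall n : nat, (1 <= n <= nsteps M)%N ->
  let m := (nsteps M - n)%N in
  let U xi alpha :=
    terminal_utility M (fun w => gam (regime M m w)) lambda F m xi alpha in
  forall xi : Omega -> R, measurable_wrt (filtr_gen P M m) xi ->
    admissible P M m xi alphahat /\
    forall a : Omega -> R, admissible P M m xi (replace_at alphahat m a) ->
      {ae P, forall w,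
        cexp P (filtr_gen P M m) (U xi (replace_at alphahat m a)) w <=
        cexp P (filtr_gen P M m) (U xi alphahat) w}.

Definition state_event (R : realType) (Omega : Type) (M : market R Omega)
    (m : nat) (xi : Omega -> R) (x : R) (i : bool) (s : R * R) : set Omega :=
  [set w | [/\ xi w = x, regime M m w = i & stocks M m w = s]].

(* E_{t_{N-n}}[-exp(-gamma (X^alpha_T - lambda F(S_T)))], the conditioning being
   on X = x, J = i, S = s at t_{N-n}, with X_{t_{N-n}} = xi. *)
Definition objective (R : realType) (d : measure_display)
    (Omega : measurableType d) (P : probability Omega R)
    (M : market R Omega) (gamma lambda : R) (F : R * R -> R) (n : nat)
    (xi : Omega -> R) (x : R) (i : bool) (s : R * R)
    (alpha : nat -> Omega -> R) : R :=
  let m := (nsteps M - n)%N in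
  cexp_event P (state_event M m xi x i s)
    (terminal_utility M (cst gamma) lambda F m xi alpha).

Definition Vbar (R : realType) (d : measure_display)
    (Omega : measurableType d) (P : probability Omega R)
    (M : market R Omega) (gamma lambda : R) (F : R * R -> R) (n : nat)
    (xi : Omega -> R) (x : R) (i : bool) (s : R * R) : R :=
  sup [set objective P M gamma lambda F n xi x i s alpha |
        alpha in [set alpha | admissible P M (nsteps M - n) xi alpha]].

Definition optimal (R : realType) (d : measure_display)
    (Omega : measurableType d) (P : probability Omega R)
    (M : market R Omega) (gamma lambda : R) (F : R * R -> R) (n : nat)
    (xi : Omega -> R) (x : R) (i : bool) (s : R * R)
    (alpha : nat -> Omega -> R) : Prop :=
  admissible P M (nsteps M - n) xi alpha /\
  objective P M gamma lambda F n xi x i s alpha =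
    Vbar P M gamma lambda F n xi x i s.

(* Main.v *)
(* Up to null sets, F_{t_n} is generated by the path of the walks and of the
   regime, which takes finitely many values; so every F_{t_n}-measurable variable,
   n <= N, is almost surely bounded and no integrability question arises.

   With a constant risk aversion the criterion does not depend on the date.  By
   backward induction, an adapted strategy can therefore be replaced by the
   equilibrium one, first at the later dates (induction hypothesis, started from
   the wealth at the next date) and then at the current date (equilibrium
   property), without decreasing the expected utility on any event of F_{t_m}:
   the equilibrium strategy is optimal.

   For uniqueness, strict concavity forces two optimal strategies to have the
   same terminal wealth.  Going backwards in time, a stake in the stock that
   cancels against an F_{t_k}-measurable variable for both values of the
   independent increment is zero, so the strategies agree at each date. *)
Require Import Defs.
From HB Require Import structures.
From mathcomp Require Import all_boot all_order all_algebra.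
From mathcomp Require Import all_classical all_reals all_analysis.
From mathcomp Require Import measurable_realfun ring lra.

Set Implicit Arguments.
Unset Strict Implicit.
Unset Printing Implicit Defensive.

Import Order.TTheory GRing.Theory Num.Theory.
Import numFieldNormedType.Exports.

Local Open Scope classical_set_scope.
Local Open Scope ring_scope.

(** * Integral comparison and conditional expectation *)

Lemma ae_le_integral (R : realType) (d : measure_display)
    (T : measurableType d) (mu : {measure set T -> \bar R}) (D : set T)
    (f g : T -> \bar R) :
  measurable D -> mu.-integrable D f -> mu.-integrable D g ->
  {ae mu, forall x, D x -> f x <= g x}%E ->
  (\int[mu]_(x in D) f x <= \int[mu]_(x in D) g x)%E.
Proof.
move=> mD intf intg [N [mN N0 fgN]].
rewrite (negligible_integral mN mD intf N0) (negligible_integral mN mD intg N0).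
have mDN : measurable (D `\` N) by exact: measurableD.
apply: le_integral => //; [exact: integrableS intf|exact: integrableS intg|].
move=> x; rewrite inE => -[Dx Nx]; apply: contrapT => fgx; apply: Nx.
by apply: fgN => /= /(_ Dx).
Qed.

Section conditional_expectation.
Context (R : realType) (d : measure_display) (Omega : measurableType d).
Variables (P : probability Omega R) (G : set (set Omega)).
Hypothesis mG : G `<=` measurable.

Lemma sub_measurable_sigma : <<s G >> `<=` measurable.
Proof. by apply: smallest_sub => //; exact: sigma_algebra_measurable. Qed.

Lemma measurable_wrtW (X : Omega -> R) :
  measurable_wrt G X -> measurable_fun setT X.
Proof. by move=> mX _ B mB; apply: sub_measurable_sigma; exact: mX. Qed.

(** The charge sending A to the integral of X over A is absolutely continuous with respect to P on
    [<<s G>>], and its Radon-Nikodym density there is a version. Hence [cexp] does not fall back on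
    its default 0 for integrable X. *)
Lemma is_cexp_cexp (X : Omega -> R) :
  P.-integrable setT (EFin \o X) -> is_cexp P G X (cexp P G X).
Proof.
move=> intX; apply: xgetPex.
have mid : measurable_fun setT (id : Omega -> g_sigma_algebraType G).
  by move=> _ B mB; rewrite setTI; exact: sub_measurable_sigma.
(* The law of the identity into the coarser measurable space is the restriction of P to
   [<<s G>>]. *)
pose idm : {mfun Omega >-> g_sigma_algebraType G} :=
  HB.pack (id : Omega -> g_sigma_algebraType G)
    (isMeasurableFun.Build _ _ _ _ _ mid).
pose PG := distribution P idm.
(* The charge instance takes [mid], which unification does not supply. *)
pose nu : {charge set (g_sigma_algebraType G) -> \bar R} :=
  measure_function_pushforward__canonical__charge_Charge
    (induced_charge intX) mid.
have null_int (A : set Omega) :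
    measurable A -> P A = 0%E -> (\int[P]_(w in A) (X w)%:E)%E = 0%E.
  move=> mA PA0; apply: null_set_integral => //=.
  apply: (@measurable_funS _ _ _ _ setT) => //.
  exact: measurable_int intX.
have nuPG : nu `<< PG.
  apply/null_content_dominatesP => A mA PA0.
  by apply: null_int PA0; exact: sub_measurable_sigma.
have RNfin x : (Radon_Nikodym nu PG x) \is a fin_num.
  exact: Radon_Nikodym_fin_num.
have fineRN : EFin \o (fine \o Radon_Nikodym nu PG) = Radon_Nikodym nu PG.
  by apply/funext => x /=; rewrite fineK.
have intRN := Radon_Nikodym_integrable nuPG.
have mRN := measurable_int _ intRN.
have intRNP : P.-integrable setT (Radon_Nikodym nu PG).
  apply/integrableP; split.
    by move=> _ B mB; apply: sub_measurable_sigma; exact: mRN.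
  move/integrableP : intRN => [_]; rewrite ge0_integral_pushforward//=.
  exact: measurableT_comp.
exists (fine \o Radon_Nikodym nu PG); split.
- by apply/measurable_EFinP; rewrite fineRN.
- by rewrite fineRN.
- move=> A mA; transitivity (nu A) => //.
  rewrite (Radon_Nikodym_integral nuPG mA) integral_pushforward//=.
  by apply: eq_integral => w _ /=; rewrite fineK.
apply: (@integrableS _ Omega _ P setT) => //.
exact: sub_measurable_sigma.
Qed.

(** Brings the equilibrium inequality into the form used by the backward induction: integrals over
    events of [<<s G>>]. *)
Lemma cexp_le_integral (X Y : Omega -> R) (A : set Omega) :
  P.-integrable setT (EFin \o X) -> P.-integrable setT (EFin \o Y) ->
  <<s G >> A -> {ae P, forall w, cexp P G X w <= cexp P G Y w} ->
  \int[P]_(w in A) X w <= \int[P]_(w in A) Y w.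
Proof.
move=> intX intY sA XY; have mA := sub_measurable_sigma sA.
have [_ iX EX] := is_cexp_cexp intX; have [_ iY EY] := is_cexp_cexp intY.
rewrite /Rintegral -EX// -EY// fine_le//.
- by apply: integrable_fin_num => //; exact: integrableS iX.
- by apply: integrable_fin_num => //; exact: integrableS iY.
apply: ae_le_integral => //; [exact: integrableS iX|exact: integrableS iY|].
by apply: filterS XY => w XYw _; rewrite lee_fin.
Qed.

End conditional_expectation.

(** * Variables determined almost surely by a finite code *)

Section finitely_determined.
Context (R : realType) (d : measure_display) (Omega : measurableType d).
Variables (P : probability Omega R) (T : finType) (f : Omega -> T).

(** A factorization of X through f off a null set, stated without naming the factoring map. For U =
    Prop it applies to events. *)
Definition ae_factors (U : Type) (X : Omega -> U) : Prop :=
  exists2 N : set Omega, P.-negligible N &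
    forall w w', ~ N w -> ~ N w' -> f w = f w' -> X w = X w'.

(** Countably many exceptional null sets, chosen by [xget], have a negligible union. *)
Lemma ae_factors_countable (U : nat -> Type) (X : forall n, Omega -> U n) :
  (forall n, ae_factors (X n)) -> ae_factors (fun w n => X n w).
Proof.
move=> XN; pose N n := xget set0 [set N : set Omega | P.-negligible N /\
  forall w w', ~ N w -> ~ N w' -> f w = f w' -> X n w = X n w'].
have HN n : P.-negligible (N n) /\
    forall w w', ~ N n w -> ~ N n w' -> f w = f w' -> X n w = X n w'.
  by have [M M0 XM] := XN n; rewrite /N; case: xgetP => [? _ //|/(_ M)[]].
exists (\bigcup_n N n); first by apply: negligible_bigcup => n; case: (HN n).
move=> w w' Nw Nw' fw; apply/functional_extensionality_dep => n.
by apply: (HN n).2 => // Nn; [apply: Nw|apply: Nw']; exists n.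
Qed.


(** The events that factor through f form a sigma-algebra; countable unions use a common exceptional
    set. *)
Lemma ae_factors_sigma (G : set (set Omega)) :
  (forall A : set Omega, G A -> ae_factors A) ->
  forall A : set Omega, <<s G >> A -> ae_factors A.
Proof.
move=> GN; apply: smallest_sub => //; split.
- by exists set0 => //; exact: negligible_set0.
- move=> A [N N0 NA]; exists N => // w w' Nw Nw' fw.
  by rewrite setTD /= /setC (NA _ _ Nw Nw' fw).
- move=> A FA.
  have [N N0 NA] : ae_factors (fun w n => A n w) by exact: ae_factors_countable.
  exists N => // w w' Nw Nw' fw; rewrite propeqE.
  split=> -[n _ An]; exists n => //.
    by rewrite -(congr1 (@^~ n) (NA _ _ Nw Nw' fw)).
  by rewrite (congr1 (@^~ n) (NA _ _ Nw Nw' fw)).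
Qed.

(** The sublevel sets at rational levels factor off a common null set, and they separate any two
    distinct values of X. *)
Lemma ae_factors_measurable (G : set (set Omega)) (X : Omega -> R) :
  (forall A : set Omega, G A -> ae_factors A) ->
  measurable_wrt G X -> ae_factors X.
Proof.
move=> GN mX.
pose A (q : rat) := [set w | X w <= ratr q].
(* The rational sublevel sets enumerated by natural numbers, with [setT] at integers coding no
   rational. *)
pose B (n : nat) := if unpickle n is Some q then A q else setT.
have BN n : ae_factors (B n).
  rewrite /B; case: unpickle => [q|]; last first.
    by exists set0 => //; exact: negligible_set0.
  apply: (ae_factors_sigma GN); rewrite /A -[X in <<s _ >> X]setTI.
  rewrite (_ : [set w | _] = X @^-1` `]-oo, ratr q]).
    by apply: mX => //; exact: measurable_itv.
  by apply/seteqP; split => w; rewrite /= in_itv.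
have [N N0 NB] := ae_factors_countable BN.
have notlt w w' : ~ N w -> ~ N w' -> f w = f w' -> ~ (X w < X w').
  move=> Nw Nw' fw /rat_in_itvoo[q]; rewrite inE /= => /itvP hq.
  have : B (pickle q) w = B (pickle q) w'.
    by rewrite -[LHS]/((B^~ w) (pickle q)) (NB _ _ Nw Nw' fw).
  rewrite /B pickleK /A /= => AA.
  have : X w' <= ratr q by rewrite -AA hq.
  by rewrite leNgt hq.
exists N => // w w' Nw Nw' fw.
have [/(notlt _ _ Nw Nw' fw)[]|/(notlt _ _ Nw' Nw (esym fw))[]|//] :=
  ltgtP (X w) (X w').
Qed.

Lemma ae_factors_bounded (X : Omega -> R) :
  ae_factors X -> exists K : R, {ae P, forall w, `|X w| <= K}.
Proof.
move=> [N N0 NX].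
(* The modulus of X at some point of the fibre over t outside N, or 0 if there is no such point. The
   maximum over the finite type T is the bound. *)
pose b (t : T) : R := match pselect (exists2 w, ~ N w & f w = t) with
  | left h => `|X (s2val (cid2 h))| | right _ => 0 end.
exists (\big[Num.max/0]_(t : T) b t).
apply: negligibleS N0 => w /=; apply: contra_notP => Nw.
apply: le_trans (le_bigmax _ _ (f w)); rewrite /b.
case: pselect => [h|[]]; last by exists w.
by case: (cid2 h) => w' Nw' fw' /=; rewrite (NX w w').
Qed.

End finitely_determined.

(** * Filtration and measurability in the market *)

Section market.
Context (R : realType) (d : measure_display) (Omega : measurableType d).
Variables (P : probability Omega R) (M : market R Omega).
Hypothesis HM : market_model P M.

Local Notation N := (nsteps M).
Local Notation FF := (filtr_gen P M).

Lemma filtr_gen_measurable (n : nat) : (n <= N)%N -> FF n `<=` measurable.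
Proof.
have [mW _ _ _ _] := walk_P HM; have [mJ _] := regime_P HM.
move=> nN A [/(complete_P HM)//|[k kn]]; have kN := leq_trans kn nN.
have [m1 m2] := mW _ kN.
case=> [[B mB ->]|[B mB ->]|[i ->]]; last exact: mJ.
- by rewrite -[X in measurable X]setTI; exact: m1.
- by rewrite -[X in measurable X]setTI; exact: m2.
Qed.

Lemma filtr_genS (m n : nat) : (m <= n)%N -> FF m `<=` FF n.
Proof.
move=> mn A [?|[k km h]]; [by left|right; exists k => //].
exact: leq_trans km mn.
Qed.

Lemma sigma_filtrS (m n : nat) (A : set Omega) :
  (m <= n)%N -> <<s FF m >> A -> <<s FF n >> A.
Proof. by move=> mn; apply: sub_sigma_algebra2; exact: filtr_genS. Qed.

Lemma measurable_filtrS (m n : nat) (X : Omega -> R) :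
  (m <= n)%N -> measurable_wrt (FF m) X -> measurable_wrt (FF n) X.
Proof. by move=> mn mX mT B mB; apply: sigma_filtrS mn _; exact: mX. Qed.

Lemma measurable_walk1 (n : nat) : measurable_wrt (FF n) (walk1 M n).
Proof.
move=> _ B mB; rewrite setTI; apply: sub_sigma_algebra; right.
by exists n => //; constructor 1; exists B.
Qed.

Lemma measurable_walk2 (n : nat) : measurable_wrt (FF n) (walk2 M n).
Proof.
move=> _ B mB; rewrite setTI; apply: sub_sigma_algebra; right.
by exists n => //; constructor 2; exists B.
Qed.

Lemma measurable_fdiff (b : nat -> Omega -> R) (n : nat) :
  (forall k, measurable_wrt (FF k) (b k)) ->
  measurable_wrt (FF n.+1) (fdiff b n).
Proof.
move=> mb; apply: measurable_funB; first exact: mb.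
by apply: (measurable_filtrS (leqnSn n)); exact: mb.
Qed.

Lemma measurable_ret1 (n : nat) :
  (n < N)%N -> measurable_wrt (FF n.+1) (ret1 M n).
Proof.
move=> nN; have [m1 v1 _ _] := coef_adapted HM nN.
have mS := measurable_filtrS (leqnSn n).
apply: measurable_funD; first by apply: measurable_funM => //; exact: mS.
apply: measurable_funM; first by apply: measurable_funM => //; exact: mS.
exact: measurable_fdiff measurable_walk1.
Qed.

Lemma measurable_ret2 (n : nat) :
  (n < N)%N -> measurable_wrt (FF n.+1) (ret2 M n).
Proof.
move=> nN; have [_ _ m2 v2] := coef_adapted HM nN.
have mS := measurable_filtrS (leqnSn n).
apply: measurable_funD; first by apply: measurable_funM => //; exact: mS.
apply: measurable_funM; first by apply: measurable_funM => //; exact: mS.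
apply: measurable_funD; apply: measurable_funM => //.
  exact: measurable_fdiff measurable_walk1.
exact: measurable_fdiff measurable_walk2.
Qed.

Lemma measurable_stocks (n : nat) : (n <= N)%N ->
  measurable_fun setT (stocks M n : g_sigma_algebraType (FF n) -> R * R).
Proof.
move=> nN; apply/measurable_fun_pairP; split.
- change (measurable_wrt (FF n) (stock1 M n)).
  elim: n nN => [|n IHn] nN; first exact: measurable_cst.
  have mn := measurable_filtrS (leqnSn n) (IHn (ltnW nN)).
  apply: measurable_funD => //; apply: measurable_funM => //.
  exact: measurable_ret1.
- change (measurable_wrt (FF n) (stock2 M n)).
  elim: n nN => [|n IHn] nN; first exact: measurable_cst.
  have mn := measurable_filtrS (leqnSn n) (IHn (ltnW nN)).
  apply: measurable_funD => //; apply: measurable_funM => //.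
  exact: measurable_ret2.
Qed.

Definition adapted (m : nat) (alpha : nat -> Omega -> R) : Prop :=
  forall k : nat, (m <= k < N)%N -> measurable_wrt (FF k) (alpha k).

Lemma wealthS (m : nat) (xi : Omega -> R) (alpha : nat -> Omega -> R)
    (k : nat) (w : Omega) : (m <= k)%N ->
  wealth M m xi alpha k.+1 w = wealth M m xi alpha k w + alpha k w * ret1 M k w.
Proof. by move=> mk; rewrite /wealth big_nat_recr//= addrA. Qed.

Lemma measurable_wealth (m : nat) (xi : Omega -> R)
    (alpha : nat -> Omega -> R) (k : nat) :
  measurable_wrt (FF m) xi -> adapted m alpha -> (m <= k <= N)%N ->
  measurable_wrt (FF k) (wealth M m xi alpha k).
Proof.
move=> mxi malpha; elim: k => [|k IHk] /andP[mk kN].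
  move: mk mxi; rewrite leqn0 => /eqP -> mxi.
  rewrite (_ : wealth _ _ _ _ _ = xi)//; apply/funext => w.
  by rewrite /wealth big_geq// addr0.
have [mk'|km] := leqP m k; last first.
  have mE : m = k.+1 by apply/eqP; rewrite eqn_leq mk.
  rewrite (_ : wealth _ _ _ _ _ = xi) -?mE//; apply/funext => w.
  by rewrite /wealth mE big_geq// addr0.
have -> : wealth M m xi alpha k.+1 =
    (fun w => wealth M m xi alpha k w + alpha k w * ret1 M k w).
  by apply/funext => w; rewrite wealthS.
have mS := measurable_filtrS (leqnSn k).
apply: measurable_funD; first by apply: mS; apply: IHk; rewrite mk' ltnW.
apply: measurable_funM; last exact: measurable_ret1.
by apply: mS; apply: malpha; rewrite mk'.
Qed.

Lemma measurable_utility (gamma lambda : R) (F : R * R -> R) (m : nat)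
    (xi : Omega -> R) (alpha : nat -> Omega -> R) :
  measurable_fun setT F -> measurable_wrt (FF m) xi -> adapted m alpha ->
  (m <= N)%N ->
  measurable_wrt (FF N) (terminal_utility M (cst gamma) lambda F m xi alpha).
Proof.
move=> mF mxi malpha mN.
have mFS : measurable_wrt (FF N) (F \o stocks M N).
  exact: measurableT_comp mF (measurable_stocks (leqnn _)).
have mW : measurable_wrt (FF N) (wealth M m xi alpha N).
  by apply: measurable_wealth => //; rewrite mN leqnn.
apply: measurableT_comp => //; apply: measurableT_comp => //.
apply: measurableT_comp => //; apply: measurable_funM => //.
by apply: measurable_funB => //; apply: measurable_funM.
Qed.

(** * Finiteness of the filtration up to null sets *)

Lemma fdiff_walk_pm1 (b : nat -> Omega -> R) (k : nat) :
  (forall n, (n <= N)%N -> measurable_fun setT (b n)) -> (k < N)%N ->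
  P (fdiff b k @^-1` [set 1]) = (2^-1)%:E ->
  P (fdiff b k @^-1` [set -1]) = (2^-1)%:E ->
  P.-negligible [set w | ~ (fdiff b k w = 1 \/ fdiff b k w = -1)].
Proof.
move=> mb kN p1 pN1.
have mfd : measurable_fun setT (fdiff b k).
  by apply: measurable_funB; apply: mb => //; exact: ltnW.
have mfd1 x : measurable (fdiff b k @^-1` [set x]).
  by rewrite -[X in measurable X]setTI; exact: mfd.
pose A := fdiff b k @^-1` [set 1] `|` fdiff b k @^-1` [set -1].
have mA : measurable A by exact: measurableU.
have PA : P A = 1%E.
  rewrite measureU//.
    by rewrite [X in (X + _)%E]p1 [X in (_ + X)%E]pN1 -EFinD -div1r -splitr.
  apply/seteqP; split => // w /= [-> /eqP].
  by rewrite -subr_eq0 opprK (_ : 1 + 1 = 2%:R)// pnatr_eq0.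
apply: (@negligibleS _ _ _ _ (~` A)) => //.
apply/negligibleP; first exact: measurableC.
have PC := probability_setC P mA.
by rewrite PA subee in PC.
Qed.

(** Comparing an increment with 1 is enough to encode it, since it is almost surely 1 or -1. *)
Definition path_code (n : nat) (w : Omega) :
    {ffun 'I_n.+1 -> bool * bool * bool} :=
  [ffun j : 'I_n.+1 => (fdiff (walk1 M) j w == 1, fdiff (walk2 M) j w == 1,
                        regime M j w)].

(** The walk starts at 0 and is the sum of its increments, each of which the code determines off a
    null set. Stated for a generic b so as to serve both walks. *)
Lemma ae_factors_walk (b : nat -> Omega -> R) (n k : nat) :
  b 0%N = cst 0 -> (k <= n)%N -> (n <= N)%N ->
  (forall j, (j < N)%N ->
    P.-negligible [set w | ~ (fdiff b j w = 1 \/ fdiff b j w = -1)]) ->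
  (forall (j : 'I_n.+1) w w', path_code n w = path_code n w' ->
    (fdiff b j w == 1) = (fdiff b j w' == 1)) ->
  ae_factors P (path_code n) (b k).
Proof.
move=> b0 kn nN pm1 code; elim: k kn => [|k IHk] kn.
  by exists set0; [exact: negligible_set0|rewrite b0].
have [B B0 HB] := IHk (ltnW kn).
have pk := pm1 _ (leq_trans kn nN).
exists (B `|` [set w | ~ (fdiff b k w = 1 \/ fdiff b k w = -1)]).
  exact: negligibleU.
move=> w w' /not_orP[Bw /contrapT dw] /not_orP[Bw' /contrapT dw'] ww'.
have bE v : b k.+1 v = b k v + fdiff b k v by rewrite /fdiff addrC subrK.
rewrite !bE (HB _ _ Bw Bw' ww'); congr (_ + _).
have kn1 : (k < n.+1)%N by rewrite ltnS ltnW.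
have := code (Ordinal kn1) _ _ ww'; rewrite /=.
have N11 : (-1 == 1 :> R) = false.
  apply/eqP => /eqP; rewrite eq_sym -subr_eq0 opprK.
  by rewrite (_ : 1 + 1 = 2%:R)// pnatr_eq0.
by case: dw => ->; case: dw' => -> //; rewrite eqxx N11.
Qed.

Lemma filtr_gen_factors (n : nat) (A : set Omega) :
  (n <= N)%N -> FF n A -> ae_factors P (path_code n) A.
Proof.
have [mW [w10 w20] pW _ _] := walk_P HM.
move=> nN [A0|[k kn]].
  (* A null generator is its own exceptional set: outside it, membership is constantly false. *)
  by exists A => // w w' Aw Aw' _; rewrite propeqE.
case=> [[B mB ->]|[B mB ->]|[i ->]].
- have [||N0 HN0 bE] := @ae_factors_walk (walk1 M) n k w10 kn nN.
  + move=> j jN; have [p1 pN1 _ _] := pW j jN.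
    by apply: fdiff_walk_pm1 => // l lN; exact: (mW l lN).1.
  + by move=> j w w' /ffunP /(_ j); rewrite !ffunE => -[].
  by exists N0 => // w w' Nw Nw' ww'; rewrite /preimage /= (bE _ _ Nw Nw' ww').
- have [||N0 HN0 bE] := @ae_factors_walk (walk2 M) n k w20 kn nN.
  + move=> j jN; have [_ _ p1 pN1] := pW j jN.
    by apply: fdiff_walk_pm1 => // l lN; exact: (mW l lN).2.
  + by move=> j w w' /ffunP /(_ j); rewrite !ffunE => -[].
  by exists N0 => // w w' Nw Nw' ww'; rewrite /preimage /= (bE _ _ Nw Nw' ww').
- exists set0 => [|w w' _ _ /ffunP /(_ (inord k))]; first exact: negligible_set0.
  by rewrite !ffunE inordK ?ltnS// => -[_ _] e; rewrite /preimage /= e.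
Qed.

(** Such a variable factors through [path_code n], hence is almost surely bounded. *)
Lemma integrable_filtr (n : nat) (X : Omega -> R) : (n <= N)%N ->
  measurable_wrt (FF n) X -> P.-integrable setT (EFin \o X).
Proof.
move=> nN mX.
have mX' := measurable_wrtW (filtr_gen_measurable nN) mX.
have [K XK] := ae_factors_bounded
  (ae_factors_measurable (fun A => @filtr_gen_factors n A nN) mX).
apply/integrableP; split; first exact/measurable_EFinP.
apply: (@le_lt_trans _ _ (\int[P]_w `|K|%:E)%E).
  apply: ae_ge0_le_integral => //=.
  - by apply/measurable_EFinP; exact: measurableT_comp.
  - by apply: filterS XK => w XwK _; rewrite lee_fin (le_trans XwK)// ler_norm.
by rewrite integral_cst//= probability_setT mule1 ltry.
Qed.

(** The wealth of an adapted strategy at t_k is measurable for F_{t_k}, hence integrable by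
    [integrable_filtr]. *)
Lemma admissible_adapted (m : nat) (xi : Omega -> R)
    (alpha : nat -> Omega -> R) :
  measurable_wrt (FF m) xi -> admissible P M m xi alpha <-> adapted m alpha.
Proof.
move=> mxi; split=> [Ha k /Ha[]//|Ha k mkN]; split; first exact: Ha.
have /andP[mk kN] := mkN.
have : P.-integrable setT (EFin \o wealth M m xi alpha k).
  apply: (integrable_filtr (ltnW kN)).
  by apply: measurable_wealth => //; rewrite mk ltnW.
by move=> /integrableP[].
Qed.

(** * Optimality of the equilibrium strategy *)

Section optimality.
Variables (gamma lambda : R) (F : R * R -> R).
Hypotheses (gamma_gt0 : 0 < gamma) (mF : measurable_fun setT F).

Local Notation U := (terminal_utility M (cst gamma) lambda F).

Lemma eq_utility (m : nat) (xi : Omega -> R) (alpha beta : nat -> Omega -> R) :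
  (forall k, (m <= k < N)%N -> alpha k = beta k) -> U m xi alpha = U m xi beta.
Proof.
move=> ab; apply/funext => w; rewrite /terminal_utility.
suff -> : wealth M m xi alpha N w = wealth M m xi beta N w by [].
by congr (_ + _); apply: eq_big_nat => k mkN; rewrite ab.
Qed.

(** Absorbing the first gain into the starting wealth lets the induction hypothesis apply at the
    next date. *)
Lemma utilityS (m : nat) (xi : Omega -> R) (alpha : nat -> Omega -> R) :
  (m < N)%N ->
  U m xi alpha = U m.+1 (fun w => xi w + alpha m w * ret1 M m w) alpha.
Proof.
move=> mN; apply/funext => w.
by rewrite /terminal_utility /wealth big_ltn// addrA.
Qed.

Lemma integrable_utility (m : nat) (xi : Omega -> R)
    (alpha : nat -> Omega -> R) :
  measurable_wrt (FF m) xi -> adapted m alpha -> (m <= N)%N ->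
  P.-integrable setT (EFin \o U m xi alpha).
Proof.
move=> mxi malpha mN; apply: (integrable_filtr (leqnn N)).
exact: measurable_utility.
Qed.

(** Measurability of [alphahat k] is read off the equilibrium condition at t_k itself, instantiated
    at zero wealth. *)
Lemma equilibrium_adapted (gam : bool -> R) (alphahat : nat -> Omega -> R) :
  equilibrium P M gam lambda F alphahat -> adapted 0 alphahat.
Proof.
move=> Heq k /andP[_ kN].
have kn : (1 <= N - k <= N)%N by rewrite subn_gt0 kN leq_subr.
have [|+ _] := Heq _ kn (cst 0); first exact: measurable_cst.
by rewrite subKn ?(ltnW kN)// => /(_ k); rewrite leqnn kN => -[].
Qed.

(* Since the risk aversion is constant, a single criterion is used at all dates
   and equilibrium optimality at each date propagates backwards. *)
Lemma equilibrium_optimal (gam : bool -> R) (alphahat : nat -> Omega -> R)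
    (n m : nat) (xi : Omega -> R) (alpha : nat -> Omega -> R) (A : set Omega) :
  gam false = gamma -> gam true = gamma ->
  equilibrium P M gam lambda F alphahat -> (m + n)%N = N ->
  measurable_wrt (FF m) xi -> adapted m alpha -> <<s FF m >> A ->
  \int[P]_(w in A) U m xi alpha w <= \int[P]_(w in A) U m xi alphahat w.
Proof.
move=> gam0 gam1 Heq; have mhat := equilibrium_adapted Heq.
elim: n m xi => [|n IHn] m xi mnN mxi malpha sA.
  (* At m = N no trading date remains, so the two utilities coincide. *)
  rewrite (@eq_utility m xi alpha alphahat)// => k.
  by rewrite -mnN addn0; case: leqP.
have mN : (m < N)%N by rewrite -mnN -addSnnS leq_addr.
have malphaS : adapted m.+1 alpha.
  by move=> k /andP[mk kN]; apply: malpha; rewrite (ltnW mk).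
(* The intermediate strategy: alpha at t_m, equilibrium afterwards. *)
pose b := replace_at alphahat m (alpha m).
have mb : adapted m b.
  move=> k /andP[mk kN]; rewrite /b /replace_at; case: eqP => [->|_].
    by apply: malpha; rewrite leqnn.
  exact: mhat.
rewrite utilityS//; set xi' := (fun w => xi w + _).
have mxi' : measurable_wrt (FF m.+1) xi'.
  have mS := measurable_filtrS (leqnSn m).
  apply: measurable_funD; first exact: mS.
  apply: measurable_funM; last exact: measurable_ret1.
  by apply: mS; apply: malpha; rewrite leqnn.
have := IHn m.+1 xi' _ mxi' malphaS (sigma_filtrS (leqnSn m) sA).
rewrite addSnnS => /(_ mnN) /le_trans; apply.
(* Following equilibrium from the wealth that alpha yields at the next date is the same as following
   b from t_m. *)
have -> : U m.+1 xi' alphahat = U m xi b.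
  rewrite (@utilityS m xi b)//.
  rewrite (_ : (fun w => xi w + b m w * _) = xi'); last first.
    by rewrite /b /replace_at eqxx.
  apply: eq_utility => k /andP[mk _]; rewrite /b /replace_at.
  by rewrite (gtn_eqF mk).
have mE : (N - n.+1)%N = m by rewrite -mnN addnK.
have nN : (1 <= n.+1 <= N)%N by rewrite /= -mnN leq_addl.
have gamE : (fun w => gam (regime M m w)) = cst gamma.
  by apply/funext => w; case: regime; rewrite ?gam0 ?gam1.
have := Heq n.+1 nN; rewrite /= mE gamE => /(_ xi mxi)[_ /(_ (alpha m))].
move=> /(_ ((admissible_adapted _ mxi).2 mb)) Hle.
apply: (cexp_le_integral (filtr_gen_measurable (ltnW mN))) => //.
- by apply: integrable_utility => //; exact: ltnW.
- apply: integrable_utility => //; last exact: ltnW.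
  by move=> k /andP[_ kN]; exact: mhat.
Qed.

(** * Uniqueness of the optimal strategy *)

Lemma wealth_mid (m : nat) (xi : Omega -> R) (alpha beta : nat -> Omega -> R)
    (k : nat) (w : Omega) :
  wealth M m xi (fun j v => (alpha j v + beta j v) / 2) k w =
  (wealth M m xi alpha k w + wealth M m xi beta k w) / 2.
Proof.
rewrite /wealth; set a := \sum_(m <= j < k) alpha j w * _.
set b := \sum_(m <= j < k) beta j w * _.
have -> : \sum_(m <= j < k) (alpha j w + beta j w) / 2 * ret1 M j w =
    (a + b) / 2.
  rewrite /a /b -big_split/= mulr_suml; apply: eq_bigr => j _.
  by rewrite -mulrDl mulrAC.
lra.
Qed.

(** Strict concavity in explicit form: the midpoint gap is a square, vanishing only when x = y. *)
Lemma expR_midpoint (x y : R) :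
  2 * - expR ((x + y) / 2) - - expR x - - expR y =
  (expR (x / 2) - expR (y / 2)) ^+ 2.
Proof.
have half (z : R) : expR z = expR (z / 2) * expR (z / 2).
  by rewrite -expRD -splitr.
have -> : (x + y) / 2 = x / 2 + y / 2 by lra.
by rewrite expRD (half x) (half y); ring.
Qed.

(* Exponential utility is strictly concave in the terminal wealth, so the
   midpoint of two optimal strategies would do strictly better if their terminal
   wealths differed. *)
Lemma optimal_wealth_eq (m : nat) (xi : Omega -> R)
    (alpha beta : nat -> Omega -> R) (A : set Omega) :
  (m <= N)%N -> measurable_wrt (FF m) xi -> adapted m alpha ->
  adapted m beta -> <<s FF m >> A ->
  \int[P]_(w in A) U m xi alpha w = \int[P]_(w in A) U m xi beta w ->
  (forall c, adapted m c ->
     \int[P]_(w in A) U m xi c w <= \int[P]_(w in A) U m xi beta w) ->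
  {ae P, forall w, A w -> wealth M m xi alpha N w = wealth M m xi beta N w}.
Proof.
move=> mN mxi malpha mbeta sA eqab bopt.
have mA := sub_measurable_sigma (filtr_gen_measurable mN) sA.
pose c := fun j v => (alpha j v + beta j v) / 2.
have mc : adapted m c.
  move=> k mkN; apply: measurable_funM => //.
  by apply: measurable_funD; [exact: malpha|exact: mbeta].
have intU a : adapted m a -> P.-integrable A (EFin \o U m xi a).
  move=> ma; apply: (integrableS measurableT) => //.
  exact: integrable_utility.
pose x a w := - (gamma * (wealth M m xi a N w - lambda * F (stocks M N w))).
(* Twice the gain of the midpoint strategy over the average of alpha and beta. Optimality makes its
   integral nonpositive, while g is a square, so g vanishes almost everywhere on A. *)
pose g w := 2 * U m xi c w - U m xi alpha w - U m xi beta w.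
have gE w : g w = (expR (x alpha w / 2) - expR (x beta w / 2)) ^+ 2.
  rewrite -expR_midpoint /g; congr (2 * - expR _ - _ - _).
  by rewrite wealth_mid /x /=; field.
have int2U : P.-integrable A (EFin \o (fun w => 2 * U m xi c w)).
  by have := integrableZl mA 2 (intU _ mc); apply: eq_integrable.
have intB :
    P.-integrable A (EFin \o (fun w => 2 * U m xi c w - U m xi alpha w)).
  by have := integrableB mA int2U (intU _ malpha); apply: eq_integrable.
have intg : P.-integrable A (EFin \o g).
  by have := integrableB mA intB (intU _ mbeta); apply: eq_integrable.
have g_le0 : \int[P]_(w in A) g w <= 0.
  rewrite (RintegralB mA intB (intU _ mbeta)).
  rewrite (RintegralB mA int2U (intU _ malpha)).
  rewrite (RintegralZl 2 mA (intU _ mc)); have := bopt _ mc; rewrite eqab.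
  move: (\int[P]_(w in A) U m xi c w) (\int[P]_(w in A) U m xi beta w) => a b.
  lra.
have g_ge0 w : 0 <= g w by rewrite gE sqr_ge0.
have g0 : (\int[P]_(w in A) `|(g w)%:E| = 0)%E.
  under eq_integral do rewrite gee0_abs ?lee_fin//.
  rewrite -[LHS]fineK ?integrable_fin_num//; congr EFin.
  apply/eqP; rewrite eq_le g_le0/=; exact: Rintegral_ge0.
have mg := measurable_int P intg.
have := (ae_eq_integral_abs P mA mg).1 g0.
apply: filterS => w gw0 Aw; have := gw0 Aw => -[].
rewrite gE => /eqP; rewrite sqrf_eq0 subr_eq0 => /eqP /expR_inj xw.
have {xw} : x alpha w = x beta w by apply: (@mulIf _ 2^-1).
by rewrite /x => /oppr_inj /(mulfI (lt0r_neq0 gamma_gt0)) /addIr.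
Qed.

(* The stock return has two distinct conditional values given the past, so a
   stake on it can only be riskless if it vanishes. *)
Lemma stake_eq0 (k : nat) (D delta : Omega -> R) (A : set Omega) :
  (k < N)%N -> measurable_wrt (FF k) D -> measurable_wrt (FF k) delta ->
  <<s FF k >> A ->
  {ae P, forall w, A w -> D w + delta w * ret1 M k w = 0} ->
  {ae P, forall w, A w -> delta w = 0}.
Proof.
move=> kN mD md sA HA; have [_ _ pW indep _] := walk_P HM.
have [p1 pN1 _ _] := pW k kN.
have [m1 v1 _ _] := coef_adapted HM kN.
(* The return with its increment frozen at s, which makes it measurable for F_{t_k}. *)
pose r (s : R) w := drift1 M k w * mesh M + vol1 M k w * Num.sqrt (mesh M) * s.
have branch (s : R) : P (fdiff (walk1 M) k @^-1` [set s]) = (2^-1)%:E ->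
    {ae P, forall w, A w -> D w + delta w * r s w = 0}.
  move=> ps; pose f w := D w + delta w * r s w.
  have mf : measurable_wrt (FF k) f.
    apply: measurable_funD => //; apply: measurable_funM => //.
    by apply: measurable_funD; [exact: measurable_funM|
      apply: measurable_funM => //; exact: measurable_funM].
  pose Z := A `&` f @^-1` (~` [set 0]).
  have sZ : <<s FF k >> Z.
    have mf0 : (FF k).-sigma.-measurable (f @^-1` (~` [set 0])).
      by rewrite -[X in measurable X]setTI; apply: mf => //; exact: measurableC.
    exact: (@measurableI _ (g_sigma_algebraType (FF k)) A _ sA mf0).
  have mZ := sub_measurable_sigma (filtr_gen_measurable (ltnW kN)) sZ.
  have mB : measurable (fst @^-1` [set s] : set (R * R)).
    by rewrite -[X in measurable X]setTI; exact: measurable_fst.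
  have PZs := indep k Z (fst @^-1` [set s]) kN sZ mB.
  have preE : dwalk M k @^-1` (fst @^-1` [set s]) =
    fdiff (walk1 M) k @^-1` [set s] by [].
  rewrite preE ps in PZs.
  have Zs0 : P.-negligible (Z `&` fdiff (walk1 M) k @^-1` [set s]).
    apply: negligibleS HA => w [[Aw fw] /= sw] /(_ Aw); apply: contra_not fw.
    by rewrite /f /r /ret1 sw.
  have PZ0 : P Z = 0%E.
    have mZs : measurable (Z `&` fdiff (walk1 M) k @^-1` [set s]).
      apply: measurableI => //; rewrite -preE -[X in measurable X]setTI.
      have [mW _ _ _ _] := walk_P HM.
      have [mW1 mW2] := mW _ kN; have [mw1 mw2] := mW _ (ltnW kN).
      by apply: (measurable_funB mW1 mw1).
    have Ps0 : (P Z * (2^-1)%:E = 0)%E.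
      by rewrite -PZs; exact: measure_negligible mZs Zs0.
    by move/eqP : Ps0; rewrite mule_eq0 eqe invr_eq0 pnatr_eq0 orbF => /eqP.
  apply: (@negligibleS _ _ _ _ Z); last by apply/negligibleP.
  by move=> w /=; rewrite not_implyE.
have h0 : 0 < mesh M.
  by rewrite divr_gt0 ?ltr0n ?(horizon_gt0 HM)// (nsteps_gt0 HM).
have := branch _ p1; have := branch _ pN1; have := vol1_neq0 HM kN.
(* The difference of the two branches is twice the stake times the volatility and the square root of
   the mesh, both nonzero. *)
apply: filterS3 => w v0 eN1 e1 Aw.
have := eN1 Aw; have := e1 Aw; rewrite /r => e1' eN1'.
have : delta w * (vol1 M k w * Num.sqrt (mesh M)) = 0 by lra.
move=> /eqP; rewrite mulf_eq0 => /orP[/eqP//|].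
by rewrite mulf_eq0 (negPf v0) sqrtr_eq0 leNgt h0.
Qed.

(** Equal wealths at t_{k+1} give equal stakes at t_k by [stake_eq0]; removing the common gain gives
    equal wealths at t_k, and so on back to t_m. *)
Lemma wealth_eq_strategy (m : nat) (xi : Omega -> R)
    (alpha beta : nat -> Omega -> R) (A : set Omega) :
  measurable_wrt (FF m) xi -> adapted m alpha -> adapted m beta ->
  <<s FF m >> A ->
  {ae P, forall w, A w -> wealth M m xi alpha N w = wealth M m xi beta N w} ->
  forall k, (m <= k < N)%N -> {ae P, forall w, A w -> alpha k w = beta k w}.
Proof.
move=> mxi malpha mbeta sA eqN.
have stake k : (m <= k < N)%N ->
    {ae P, forall w, A w ->
      wealth M m xi alpha k.+1 w = wealth M m xi beta k.+1 w} ->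
    {ae P, forall w, A w -> alpha k w = beta k w}.
  move=> mkN eqk; have /andP[mk kN] := mkN.
  pose D w := wealth M m xi alpha k w - wealth M m xi beta k w.
  have mkN' : (m <= k <= N)%N by rewrite mk ltnW.
  have mD : measurable_wrt (FF k) D.
    by apply: measurable_funB; exact: measurable_wealth.
  have md : measurable_wrt (FF k) (fun w => alpha k w - beta k w).
    by apply: measurable_funB; [exact: malpha|exact: mbeta].
  have : {ae P, forall w, A w -> D w + (alpha k w - beta k w) * ret1 M k w = 0}.
    apply: filterS eqk => w ew Aw; have := ew Aw.
    by rewrite !wealthS// /D; lra.
  move=> /(stake_eq0 kN mD md (sigma_filtrS mk sA)).
  by apply: filterS => w dw Aw; apply/eqP; rewrite -subr_eq0 dw.
(* Descending induction on k, carried by j = N - k. *)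
have eqW j k : (k + j)%N = N -> (m <= k)%N ->
    {ae P, forall w, A w -> wealth M m xi alpha k w = wealth M m xi beta k w}.
  elim: j k => [|j IHj] k; first by rewrite addn0 => -> _.
  rewrite -addSnnS => kjN mk; have eqk := IHj _ kjN (leqW mk).
  have mkN : (m <= k < N)%N by rewrite mk -kjN leq_addr.
  have eqs := stake k mkN eqk.
  apply: filterS2 eqk eqs => w ew sw Aw; have := ew Aw.
  by rewrite !wealthS// sw// => /addIr.
move=> k mkN; apply: stake => //; have /andP[mk kN] := mkN.
by apply: (eqW (N - k.+1)%N); [rewrite subnKC|exact: leqW].
Qed.

End optimality.

(** * State events and conclusion *)

Lemma state_event_filtr (m : nat) (xi : Omega -> R) (x : R) (i : bool)
    (s : R * R) : (m <= N)%N -> measurable_wrt (FF m) xi ->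
  <<s FF m >> (state_event M m xi x i s).
Proof.
move=> mN mxi.
have -> : state_event M m xi x i s =
    (xi @^-1` [set x] `&` regime M m @^-1` [set i]) `&`
    stocks M m @^-1` [set s].
  by apply/seteqP; split => w /= [] // []; split.
apply: (@measurableI _ (g_sigma_algebraType (FF m))).
  apply: (@measurableI _ (g_sigma_algebraType (FF m))).
    by rewrite -[X in measurable X]setTI; exact: mxi.
  apply: sub_sigma_algebra; right; exists m => //.
  by constructor 3; exists i.
rewrite -[X in measurable X]setTI; apply: measurable_stocks => //.
case: s => a b; rewrite (_ : [set (a, b)] = [set a] `*` [set b]).
  exact: measurableX.
by apply/seteqP; split => -[u v] /= [-> ->].
Qed.

End market.

Theorem corollary3p5 (R : realType) (d : measure_display)
    (Omega : measurableType d) (P : probability Omega R)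
    (M : market R Omega) (gam : bool -> R) (gamma lambda : R)
    (F : R * R -> R) (alphahat : nat -> Omega -> R)
    (HM : market_model P M)
    (gamma_gt0 : 0 < gamma)
    (gam0 : gam false = gamma) (gam1 : gam true = gamma)
    (lambda_ge0 : 0 <= lambda)
    (F_meas : measurable_fun setT F)
    (Heq : equilibrium P M gam lambda F alphahat) :
  forall n : nat, (1 <= n <= nsteps M)%N ->
  forall xi : Omega -> R, measurable_wrt (filtr_gen P M (nsteps M - n)) xi ->
    (exists alpha : nat -> Omega -> R,
       forall (x : R) (i : bool) (s : R * R),
         (0 < P (state_event M (nsteps M - n) xi x i s))%E ->
         optimal P M gamma lambda F n xi x i s alpha) /\
    (forall (x : R) (i : bool) (s : R * R),
       (0 < P (state_event M (nsteps M - n) xi x i s))%E ->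
       forall alphabar : nat -> Omega -> R,
         optimal P M gamma lambda F n xi x i s alphabar ->
         forall k : nat, (nsteps M - n <= k < nsteps M)%N ->
           {ae P, forall w, state_event M (nsteps M - n) xi x i s w ->
             alphabar k w = alphahat k w}).

Proof.
move=> n /andP[n_gt0 nN] xi mxi; set m := (nsteps M - n)%N in mxi *.
have mnN : (m + n)%N = nsteps M by rewrite subnK.
have mN : (m <= nsteps M)%N by rewrite leq_subr.
have mhat : adapted P M m alphahat.
  by move=> k /andP[_ kN]; exact: (equilibrium_adapted Heq).
have ahat := (admissible_adapted HM alphahat mxi).2 mhat.
(* On a fixed state event the objective is an integral divided by a constant, so comparisons on
   events of F_{t_m} carry over to it. *)
have objE x i s alpha : objective P M gamma lambda F n xi x i s alpha =
  (\int[P]_(w in state_event M m xi x i s)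
     terminal_utility M (cst gamma) lambda F m xi alpha w) /
  fine (P (state_event M m xi x i s)) by [].
have P_gt0 x i s : (0 < P (state_event M m xi x i s))%E ->
    0 < fine (P (state_event M m xi x i s)).
  move=> P0; rewrite fine_gt0// P0/= ltey_eq fin_num_measure//.
  apply: (sub_measurable_sigma (filtr_gen_measurable HM mN)).
  exact: state_event_filtr.
have hat_opt x i s : (0 < P (state_event M m xi x i s))%E ->
    objective P M gamma lambda F n xi x i s alphahat =
    Vbar P M gamma lambda F n xi x i s.
  move=> P0.
  (* The equilibrium value bounds the objectives of all admissible strategies and is one of them, so
     it is the supremum. *)
  have ub : ubound [set objective P M gamma lambda F n xi x i s alpha |
      alpha in [set alpha | admissible P M m xi alpha]]
      (objective P M gamma lambda F n xi x i s alphahat).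
    move=> _ [alpha /(admissible_adapted HM _ mxi) malpha <-].
    rewrite !objE ler_pM2r ?invr_gt0 ?P_gt0//.
    apply: (equilibrium_optimal HM F_meas gam0 gam1 Heq mnN) => //.
    exact: state_event_filtr.
  apply/eqP; rewrite eq_le; apply/andP; split.
    apply: ub_le_sup; last by exists alphahat.
    by exists (objective P M gamma lambda F n xi x i s alphahat).
  apply: ge_sup => //.
  by exists (objective P M gamma lambda F n xi x i s alphahat), alphahat.
(* The equilibrium strategy attains the supremum in all states at once. *)
split; first by exists alphahat => x i s P0; split => //; exact: hat_opt.
move=> x i s P0 alphabar [/(admissible_adapted HM _ mxi) mbar].
(* Cancelling the positive probability of the state event leaves equal integrals of utility, as
   [optimal_wealth_eq] requires. *)
rewrite -hat_opt// !objE => /divIf eqbar k mkN.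
have sA := state_event_filtr HM x i s mN mxi.
apply: (wealth_eq_strategy HM mxi) mkN => //.
apply: (@optimal_wealth_eq _ _ _ _ _ HM gamma lambda F) => //.
  by apply: eqbar; rewrite lt0r_neq0// P_gt0.
by move=> c mc; exact: (equilibrium_optimal HM F_meas gam0 gam1 Heq mnN).
Qed.
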